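(* Let $\{\pi^k\}_{k\ge0}$ be generated by entropy softmax natural policy gradient with constant step size $\eta>0$. There exist values $\sigma_1(\varepsilon,\delta)\ge0$ and $\sigma_2(\varepsilon,\delta)\ge0$, defined for $\varepsilon,\delta\in(0,1)$ and approaching $0$ as $\varepsilon\to0,\ \delta\to0$, such that the following holds. Let $\varepsilon,\delta\in(0,1)$ and let $T(\varepsilon,\delta)$ be a time such that for all $k\ge T(\varepsilon,\delta)$ and all $s\in\mathcal{S}$, $$\left|\frac{\mathrm{KL}(\pi_s^k\|\pi_s^{k+1})}{\mathrm{KL}(\pi_s^{k+1}\|\pi_s^k)}-1\right|\le\varepsilon,\quad\left|\frac{\mathrm{KL}(\pi_s^{k+1}\|\pi_s^k)}{\mathrm{KL}(\pi_s^k\|\pi_s^{k+1})}-1\right|\le\varepsilon,\quad\left|\frac{\mathrm{KL}(\pi_s^k\|\pi_s^* )}{\mathrm{KL}(\pi_s^*\|\pi_s^k)}-1\right|\le\varepsilon,\quad\left|\frac{\mathrm{KL}(\pi_s^*\|\pi_s^k)}{\mathrm{KL}(\pi_s^k\|\pi_s^* )}-1\right|\le\varepsilon,$$ and $$\left|\frac{d_\rho^*(s)}{d_\rho^k(s)}-1\right|\le\delta,\qquad\left|\frac{d_\rho^k(s)}{d_\rho^*(s)}-1\right|\le\delta.$$ Then for all $k\ge T(\varepsilon,\delta)$, $$\frac{1-\sigma_1(\varepsilon,\delta)}{(\eta\tau+1)^2}\left(V_\tau^*(\rho)-V_\tau^k(\rho)\right)\le V_\tau^*(\rho)-V_\ta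u^{k+1}(\rho)\le\frac{1+\sigma_2(\varepsilon,\delta)}{(\eta\tau+1)^2}\left(V_\tau^*(\rho)-V_\tau^k(\rho)\right).$$
   Context: MDP: a tuple $(\mathcal{S},\mathcal{A},P,r,\gamma)$ with finite state space $\mathcal{S}$, finite action space $\mathcal{A}$, transition probabilities $P(s'|s,a)$, reward $r:\mathcal{S}\times\mathcal{A}\to[0,1]$ and discount factor $\gamma\in[0,1)$. A policy is $\pi=(\pi(\cdot|s))_{s\in\mathcal{S}}$ with each $\pi_s=\pi(\cdot|s)$ a probability distribution on $\mathcal{A}$. For a regularization parameter $\tau>0$, the entropy regularized values are $V_\tau^\pi(s)=\mathbb{E}[\sum_{t\ge0}\gamma^t(r(s_t,a_t)-\tau\log\pi(a_t|s_t))\mid s_0=s,\pi]$, $Q_\tau^\pi(s,a)=r(s,a)+\gamma\,\mathbb{E}_{s'\sim P(\cdot|s,a)}[V_\tau^\pi(s')]$, $A_\tau^\pi(s,a)=Q_\tau^\pi(s,a)-\tau\log\pi(a|s)-V_\tau^\pi(s)$, and $V_\tau^\pi(\rho)=\mathbb{E}_{s\sim\rho}[V_\tau^\pi(s)]$. $V_\tau^*$ is the optimal regularized state value and $\pi^*$ the (unique) optimal policy of the regularized problem. $\mathrm{KL}(p\|q)=\sum_ap(a)\log\frac{p(a)}{q(a)}$. Visitation measure: $d_\rho^\pi(s)=(1-\gamma)\mathbb{E}[\sum_{t\ge0}\gamma^t\mathbf{1}\{s_t=s\}\mid s_0\sim\rho,\pi]$; $d_\rho^*=d_\rho^{\pi^*}$,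 $d_\rho^k=d_\rho^{\pi^k}$; also $V_\tau^k=V_\tau^{\pi^k}$, $A_\tau^k=A_\tau^{\pi^k}$. $\rho$ is an arbitrary probability distribution on $\mathcal{S}$ with $\min_s\rho(s)>0$. A ratio $0/0$ of KL divergences is read as $1$. Entropy softmax NPG: start from any policy $\pi^0$ with all entries positive (a softmax policy) and iterate $$\pi^{k+1}(a|s)=\frac{\pi^k(a|s)\exp\left(\frac{\eta}{\eta\tau+1}A_\tau^k(s,a)\right)}{\sum_{a'}\pi^k(a'|s)\exp\left(\frac{\eta}{\eta\tau+1}A_\tau^k(s,a')\right)}.$$ The paper notes that for every $\varepsilon,\delta\in(0,1)$ a time $T(\varepsilon,\delta)$ with the properties in the claim exists. *)

(* Defs.v *)
From HB Require Import structures.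
From mathcomp Require Import all_boot all_order all_algebra.
From mathcomp Require Import all_classical all_reals all_analysis.

Set Implicit Arguments.
Unset Strict Implicit.
Unset Printing Implicit Defensive.

Import Order.TTheory GRing.Theory Num.Theory.
Import numFieldNormedType.Exports.

Local Open Scope classical_set_scope.
Local Open Scope ring_scope.

Definition is_dist (R : realType) (T : finType) (p : T -> R) : Prop :=
  (forall x, 0 <= p x) /\ \sum_(x : T) p x = 1.

(* [trans M s a s'] is P(s' | s, a). *)
Record mdp (R : realType) (S A : finType) := Mdp {
  trans : S -> A -> S -> R;
  reward : S -> A -> R;
  discount : R;
  trans_dist : forall s a, is_dist (trans s a);
  reward_01 : forall s a, 0 <= reward s a <= 1;
  discount_01 : 0 <= discount < 1
}.

(* [pi s a] is pi(a | s). *)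
Definition is_policy (R : realType) (S A : finType) (pi : S -> A -> R) : Prop :=
  forall s, is_dist (pi s).

(* Expectation of [f [:: (s_0, a_0); ...; (s_(n-1), a_(n-1))]] when s_0 ~ mu,
   a_t ~ pi(. | s_t) and s_(t+1) ~ P(. | s_t, a_t). *)
Fixpoint traj_expect (R : realType) (S A : finType) (M : mdp R S A)
    (pi : S -> A -> R) (n : nat) (mu : S -> R) (f : seq (S * A) -> R) : R :=
  if n is m.+1 then
    \sum_(s : S) mu s * \sum_(a : A) pi s a *
      traj_expect M pi m (trans M s a) (fun w => f ((s, a) :: w))
  else f [::].

Definition discounted_sum (R : realType) (S A : finType) (M : mdp R S A)
    (c : S -> A -> R) (w : seq (S * A)) : R :=
  \sum_(t < size w) discount M ^+ t * [seq c x.1 x.2 | x <- w]`_t.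

(* E[sum_(t >= 0) gamma^t c(s_t, a_t) | s_0 ~ mu, pi], as the limit over the
   horizon n of the expectation of the sum over t < n.  The values of c are
   bounded on the reachable pairs and gamma < 1, so limit and expectation
   commute. *)
Definition expected_discounted_sum (R : realType) (S A : finType)
    (M : mdp R S A) (pi : S -> A -> R) (mu : S -> R) (c : S -> A -> R) : R :=
  limn (fun n => traj_expect M pi n mu (discounted_sum M c)).

Definition point_mass (R : realType) (S : finType) (s : S) : S -> R :=
  fun s' => (s' == s)%:R.

(* Since [ln 0 = 0], pairs with pi(a | s) = 0, which are reached with
   probability 0, contribute nothing, as with the usual 0 log 0 = 0. *)
Definition V (R : realType) (S A : finType) (M : mdp R S A) (tau : R)
    (pi : S -> A -> R) (s : S) : R :=
  expected_discounted_sum M pi (point_mass R s)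
    (fun s' a => reward M s' a - tau * ln (pi s' a)).

Definition Q (R : realType) (S A : finType) (M : mdp R S A) (tau : R)
    (pi : S -> A -> R) (s : S) (a : A) : R :=
  reward M s a + discount M * \sum_(s' : S) trans M s a s' * V M tau pi s'.

Definition Adv (R : realType) (S A : finType) (M : mdp R S A) (tau : R)
    (pi : S -> A -> R) (s : S) (a : A) : R :=
  Q M tau pi s a - tau * ln (pi s a) - V M tau pi s.

Definition Vopt (R : realType) (S A : finType) (M : mdp R S A) (tau : R)
    (s : S) : R :=
  sup [set V M tau pi s | pi in [set pi | @is_policy R S A pi]].

Definition is_optimal (R : realType) (S A : finType) (M : mdp R S A) (tau : R)
    (pi : S -> A -> R) : Prop :=
  is_policy pi /\
  forall pi', is_policy pi' -> forall s, V M tau pi' s <= V M tau pi s.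

Definition avg (R : realType) (S : finType) (rho : S -> R) (f : S -> R) : R :=
  \sum_(s : S) rho s * f s.

Definition visitation (R : realType) (S A : finType) (M : mdp R S A)
    (pi : S -> A -> R) (rho : S -> R) (s : S) : R :=
  (1 - discount M) *
  expected_discounted_sum M pi rho (fun s' _ => (s' == s)%:R).

(* Correct when p x = 0 (the term is 0); meaningful only for q x > 0 wherever
   p x > 0, since the value +oo is not represented. *)
Definition KL (R : realType) (T : finType) (p q : T -> R) : R :=
  \sum_(x : T) p x * ln (p x / q x).

(* x / y with the convention 0 / 0 = 1. *)
Definition kl_ratio (R : realType) (x y : R) : R :=
  if (x == 0) && (y == 0) then 1 else x / y.

Definition npg_step (R : realType) (S A : finType) (M : mdp R S A)
    (tau eta : R) (pi : S -> A -> R) (s : S) (a : A) : R :=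
  pi s a * expR (eta / (eta * tau + 1) * Adv M tau pi s a) /
  \sum_(a' : A) pi s a' * expR (eta / (eta * tau + 1) * Adv M tau pi s a').

Definition npg_sequence (R : realType) (S A : finType) (M : mdp R S A)
    (tau eta : R) (pi : nat -> S -> A -> R) : Prop :=
  [/\ is_policy (pi 0%N),
      forall s a, 0 < pi 0%N s a &
      forall k s a, pi k.+1 s a = npg_step M tau eta (pi k) s a].

Definition kl_close (R : realType) (T : finType) (eps : R) (p q : T -> R) :
    Prop :=
  `|kl_ratio (KL p q) (KL q p) - 1| <= eps /\
  `|kl_ratio (KL q p) (KL p q) - 1| <= eps.

(* Main.v *)
(* Write alpha = tau + 1/eta, occ_p = d_rho^p / (1 - gamma), and let o stand for
   the optimal policy.  An NPG step makes A^k equal to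
   alpha ln (pi^(k+1) / pi^k) up to a function of the state, so the performance
   difference lemma gives
     V^o - V^k = sum occ_o (KL[o|k]/eta - alpha KL[o|k+1] + alpha KL[k|k+1]),
     V^(k+1) - V^k = sum occ_(k+1) (KL[k+1|k]/eta + alpha KL[k|k+1]),
   while A^o = 0 gives V^o - V^k = tau sum occ_k KL[k|o].  Exchanging the two
   arguments of KL and the occupancy measures costs a factor of at most
   m = (1 + eps) (1 + delta); if m were 1, eliminating sum occ_o KL[k|k+1] from
   these identities would give V^o - V^(k+1) = (V^o - V^k) / (eta tau + 1)^2
   exactly, and in general the error is linear in m - 1. *)
Require Import Defs.
From mathcomp Require Import all_boot all_order all_algebra.
From mathcomp Require Import all_classical all_reals all_analysis.
From mathcomp Require Import ring lra.

Import Order.TTheory GRing.Theory Num.Theory.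
Import numFieldNormedType.Exports.

Local Open Scope classical_set_scope.
Local Open Scope ring_scope.

Set Implicit Arguments.
Unset Strict Implicit.

(** * Limits of finite sums, and point masses *)

Lemma cvg_sum_fin (R : realType) (I : finType) (f : I -> nat -> R)
    (a : I -> R) :
  (forall i, f i n @[n --> \oo] --> a i) ->
  (\sum_i f i n) @[n --> \oo] --> \sum_i a i.
Proof.
move=> fa; apply: cvg_big => [|i _]; last exact: fa.
exact: add_continuous.
Qed.

Lemma dist_point_mass (R : realType) (T : finType) (x : T) :
  is_dist (point_mass R x).
Proof.
split=> [y|]; first exact: ler0n.
by rewrite (bigD1 x) //= /point_mass eqxx big1 ?addr0 // => y /negPf ->.
Qed.

Lemma sum_point_mass (R : realType) (T : finType) (x : T) (f : T -> R) :
  \sum_y point_mass R x y * f y = f x.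
Proof.
rewrite (bigD1 x) //= /point_mass eqxx mul1r big1 ?addr0 // => y /negPf ->.
by rewrite mul0r.
Qed.

Lemma sum_point_massr (R : realType) (T : finType) (x : T) (f : T -> R) :
  \sum_y f y * point_mass R y x = f x.
Proof.
rewrite -[RHS](sum_point_mass x f); apply: eq_bigr => y _.
by rewrite mulrC /point_mass eq_sym.
Qed.

Lemma dist_avg_const (R : realType) (T : finType) (p : T -> R) (c : R) :
  is_dist p -> \sum_x p x * c = c.
Proof. by move=> [_ p1]; rewrite -mulr_suml p1 mul1r. Qed.

(** * Discounted occupancy measures, policy evaluation and the Bellman equation *)

Section Occupancy.
Variables (R : realType) (S A : finType) (M : mdp R S A) (pi : S -> A -> R).
Hypothesis pi_policy : is_policy pi.

Let gamma := discount M.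

Definition state_kernel (s s' : S) : R := \sum_a pi s a * trans M s a s'.

Fixpoint kernel_iter (n : nat) (s s' : S) : R :=
  if n is m.+1 then \sum_x state_kernel s x * kernel_iter m x s'
  else point_mass R s s'.

Definition resolvent_partial (n : nat) (s s' : S) : R :=
  series (fun t => gamma ^+ t * kernel_iter t s s') n.

(** The Neumann series of [state_kernel]: as a matrix, the inverse of I - gamma P_pi. *)
Definition resolvent (s s' : S) : R := limn (fun n => resolvent_partial n s s').

(** Left unnormalized: for a distribution [mu], [visitation] is this measure times [1 - gamma], so
    ratios of either kind agree. *)
Definition occupancy (mu : S -> R) (s : S) : R := \sum_x mu x * resolvent x s.

Lemma sum_state_kernel (s : S) (f : S -> R) :
  \sum_x state_kernel s x * f x =
  \sum_a pi s a * \sum_x trans M s a x * f x.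
Proof.
under eq_bigr do rewrite mulr_suml; rewrite exchange_big /=.
apply: eq_bigr => a _; rewrite mulr_sumr; apply: eq_bigr => x _.
by rewrite mulrA.
Qed.

Lemma state_kernel_ge0 (s s' : S) : 0 <= state_kernel s s'.
Proof.
apply: sumr_ge0 => a _; apply: mulr_ge0; first exact: (pi_policy s).1.
exact: (trans_dist M s a).1.
Qed.

Lemma state_kernel_sum1 (s : S) : \sum_x state_kernel s x = 1.
Proof.
under eq_bigr do rewrite -[state_kernel _ _]mulr1; rewrite sum_state_kernel.
rewrite -[RHS](pi_policy s).2; apply: eq_bigr => a _.
by rewrite dist_avg_const ?mulr1 //; exact: trans_dist.
Qed.

Lemma kernel_iterSr (n : nat) (s s' : S) :
  kernel_iter n.+1 s s' = \sum_x kernel_iter n s x * state_kernel x s'.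
Proof.
elim: n s => [|n IHn] s.
  by rewrite /= sum_point_mass sum_point_massr.
rewrite -[LHS]/(\sum_x state_kernel s x * kernel_iter n.+1 x s').
under eq_bigr do rewrite IHn mulr_sumr.
rewrite exchange_big /=; apply: eq_bigr => x _.
by rewrite mulr_suml; apply: eq_bigr => y _; rewrite mulrA.
Qed.

Lemma kernel_iter_01 (n : nat) (s s' : S) : 0 <= kernel_iter n s s' <= 1.
Proof.
elim: n s => [|n IHn] s; first by rewrite /= ler0n /= lern1 leq_b1.
apply/andP; split.
  apply: sumr_ge0 => x _; apply: mulr_ge0; first exact: state_kernel_ge0.
  by case/andP: (IHn x).
rewrite -(state_kernel_sum1 s); apply: ler_sum => x _.
by apply: ler_piMr; [exact: state_kernel_ge0 | case/andP: (IHn x)].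
Qed.

(** The entries of [kernel_iter] are at most 1, so the geometric series of [gamma] dominates
    termwise. *)
Lemma resolvent_cvg (s s' : S) :
  resolvent_partial n s s' @[n --> \oo] --> resolvent s s'.
Proof.
have /andP[g0 g1] := discount_01 M.
suff: cvgn (fun n => resolvent_partial n s s') by [].
apply: (@series_le_cvg _ _ (geometric 1 gamma)) => [n|n|n|] /=.
- by rewrite mulr_ge0 ?exprn_ge0 //; case/andP: (kernel_iter_01 n s s').
- by rewrite mul1r exprn_ge0.
- rewrite mul1r ler_piMr ?exprn_ge0 //.
  by case/andP: (kernel_iter_01 n s s').
- by apply: is_cvg_geometric_series; rewrite ger0_norm.
Qed.

(** Splitting off the first transition serves trajectory expectations and the Bellman equation;
    splitting off the last one, in [resolvent_partialSr], leads to the flow equation of the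
    occupancy measure. *)
Lemma resolvent_partialSl (n : nat) (s s' : S) :
  resolvent_partial n.+1 s s' =
  point_mass R s s' +
  gamma * \sum_x state_kernel s x * resolvent_partial n x s'.
Proof.
rewrite /resolvent_partial /series /= big_nat_recl //= expr0 mul1r.
congr (_ + _); under [in RHS]eq_bigr do rewrite mulr_sumr.
rewrite exchange_big mulr_sumr /=; apply: eq_bigr => t _.
rewrite exprS -mulrA; congr (_ * _); rewrite mulr_sumr; apply: eq_bigr => x _.
by rewrite mulrCA.
Qed.

Lemma resolvent_partialSr (n : nat) (s s' : S) :
  resolvent_partial n.+1 s s' =
  point_mass R s s' +
  gamma * \sum_x resolvent_partial n s x * state_kernel x s'.
Proof.
rewrite /resolvent_partial /series /= big_nat_recl //= expr0 mul1r.
congr (_ + _); under [in RHS]eq_bigr do rewrite mulr_suml.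
rewrite exchange_big mulr_sumr /=; apply: eq_bigr => t _.
rewrite -/(kernel_iter t.+1 s s') kernel_iterSr.
rewrite exprS -mulrA; congr (_ * _); rewrite mulr_sumr; apply: eq_bigr => x _.
by rewrite mulrA.
Qed.

Lemma resolvent_fixl (s s' : S) :
  resolvent s s' =
  point_mass R s s' + gamma * \sum_x state_kernel s x * resolvent x s'.
Proof.
have /cvg_lim <- // :
    resolvent_partial n.+1 s s' @[n --> \oo] --> resolvent s s'.
  by have := @resolvent_cvg s s'; rewrite -cvg_shiftS.
apply: cvg_lim => //; under eq_fun do rewrite resolvent_partialSl.
apply: cvgD; first exact: cvg_cst.
apply: cvgMl_tmp; apply: cvg_sum_fin => x; apply: cvgMl_tmp.
exact: resolvent_cvg.
Qed.

Lemma resolvent_fixr (s s' : S) :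
  resolvent s s' =
  point_mass R s s' + gamma * \sum_x resolvent s x * state_kernel x s'.
Proof.
have /cvg_lim <- // :
    resolvent_partial n.+1 s s' @[n --> \oo] --> resolvent s s'.
  by have := @resolvent_cvg s s'; rewrite -cvg_shiftS.
apply: cvg_lim => //; under eq_fun do rewrite resolvent_partialSr.
apply: cvgD; first exact: cvg_cst.
apply: cvgMl_tmp; apply: cvg_sum_fin => x; apply: cvgMr_tmp.
exact: resolvent_cvg.
Qed.

Lemma resolvent_ge0 (s s' : S) : 0 <= resolvent s s'.
Proof.
have /andP[g0 _] := discount_01 M.
apply: limr_ge; first exact: resolvent_cvg.
apply: nearW => n; apply: sumr_ge0 => t _; rewrite mulr_ge0 ?exprn_ge0 //.
by case/andP: (kernel_iter_01 t s s').
Qed.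

(** Prefixing a pair makes [discounted_sum] an affine function of the sum along the tail, so the
    induction has to range over all [b] and [g]; [b = 0] and [g = 1] recover the sum itself. *)
Lemma traj_expect_affine (c : S -> A -> R) (n : nat) (mu : S -> R) (b g : R) :
  is_dist mu ->
  traj_expect M pi n mu (fun w => b + g * discounted_sum M c w) =
  b + g * \sum_x mu x * \sum_s resolvent_partial n x s * \sum_a pi s a * c s a.
Proof.
elim: n mu b g => [|n IHn] mu b g mu_dist.
  rewrite /= /discounted_sum big_ord0; congr (_ + _ * _).
  rewrite big1 // => x _; rewrite big1 ?mulr0 // => s _.
  by rewrite /resolvent_partial /series /= big_geq // mul0r.
have disc_cons s a : (fun w => b + g * discounted_sum M c ((s, a) :: w)) =
    (fun w => (b + g * c s a) + (g * gamma) * discounted_sum M c w).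
  apply/funext => w; rewrite /discounted_sum /= big_ord_recl expr0 mul1r /=.
  rewrite mulrDr addrA -mulrA.
  congr (_ + _ * _); rewrite mulr_sumr; apply: eq_bigr => t _.
  by rewrite /bump leq0n add1n exprS mulrA.
rewrite /=.
under eq_bigr => s _.
  under eq_bigr => a _.
    rewrite disc_cons IHn; last exact: trans_dist.
    over.
  over.
rewrite -[b in RHS](dist_avg_const b mu_dist) mulr_sumr -big_split /=.
apply: eq_bigr => s _; rewrite mulrCA -mulrDr; congr (_ * _).
rewrite -[b in RHS](dist_avg_const b (pi_policy s)).
under [in RHS]eq_bigr do rewrite resolvent_partialSl mulrDl.
rewrite big_split /= sum_point_mass mulrDr addrA mulr_sumr -big_split /=.
under eq_bigr do rewrite mulrDr.
rewrite big_split /=; congr (_ + _).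
  by apply: eq_bigr => a _; rewrite mulrDr [_ * (g * _)]mulrCA.
under [in RHS]eq_bigr do rewrite -mulrA.
rewrite -mulr_sumr mulrA.
under eq_bigr do rewrite mulrCA.
rewrite -mulr_sumr -sum_state_kernel; congr (_ * _).
under [RHS]eq_bigr do rewrite mulr_suml; rewrite exchange_big /=.
apply: eq_bigr => x _; rewrite mulr_sumr; apply: eq_bigr => y _.
by rewrite mulrA.
Qed.

Lemma expected_discounted_sumE (mu : S -> R) (c : S -> A -> R) :
  is_dist mu ->
  expected_discounted_sum M pi mu c =
  \sum_s occupancy mu s * \sum_a pi s a * c s a.
Proof.
move=> mu_dist; apply: cvg_lim => //.
have -> : (fun n => traj_expect M pi n mu (discounted_sum M c)) = (fun n =>
    \sum_x mu x * \sum_s resolvent_partial n x s * \sum_a pi s a * c s a).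
  apply/funext => n; rewrite -[RHS]mul1r -[RHS]add0r -traj_expect_affine //.
  by congr traj_expect; apply/funext => w; rewrite add0r mul1r.
under [X in _ --> X]eq_bigr do rewrite mulr_suml.
rewrite exchange_big /=.
apply: cvg_sum_fin => x.
under eq_bigr do rewrite -mulrA.
rewrite -mulr_sumr; apply: cvgMl_tmp; apply: cvg_sum_fin => s.
by apply: cvgMr_tmp; exact: resolvent_cvg.
Qed.

Lemma occupancy_flow (mu : S -> R) (s : S) :
  occupancy mu s = mu s + gamma * \sum_x occupancy mu x * state_kernel x s.
Proof.
rewrite /occupancy; under eq_bigr do rewrite resolvent_fixr mulrDr.
rewrite big_split /= sum_point_massr; congr (_ + _).
under [LHS]eq_bigr do rewrite mulrCA.
rewrite -mulr_sumr; congr (_ * _).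
under [LHS]eq_bigr do rewrite mulr_sumr; rewrite exchange_big /=.
apply: eq_bigr => x _; rewrite mulr_suml; apply: eq_bigr => y _.
by rewrite mulrA.
Qed.

(** The visit at time 0 already contributes [mu s]. Hence a start of full support makes every
    occupancy positive, and a point mass gives its own state occupancy at least 1. *)
Lemma occupancy_ge (mu : S -> R) (s : S) :
  (forall x, 0 <= mu x) -> mu s <= occupancy mu s.
Proof.
have /andP[g0 _] := discount_01 M.
move=> mu0; rewrite occupancy_flow lerDl mulr_ge0 // sumr_ge0 // => x _.
rewrite mulr_ge0 ?state_kernel_ge0 // sumr_ge0 // => y _.
by rewrite mulr_ge0 ?resolvent_ge0.
Qed.

Lemma visitationE (mu : S -> R) (s : S) :
  is_dist mu -> visitation M pi mu s = (1 - gamma) * occupancy mu s.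
Proof.
move=> mu_dist; rewrite /visitation expected_discounted_sumE //; congr (_ * _).
under eq_bigr do rewrite dist_avg_const //.
rewrite -[RHS](sum_point_mass s); apply: eq_bigr => x _; exact: mulrC.
Qed.

(* Weighting the Bellman residual of f by the occupancy measure telescopes,
   because of the flow equation. *)
Lemma bellman_residual (mu f : S -> R) (c : S -> A -> R) :
  is_dist mu ->
  expected_discounted_sum M pi mu c - avg mu f =
  \sum_s occupancy mu s *
    (\sum_a pi s a * (c s a + gamma * \sum_x trans M s a x * f x) - f s).
Proof.
move=> mu_dist; rewrite expected_discounted_sumE //.
have -> : avg mu f = \sum_s occupancy mu s *
    (f s - gamma * \sum_x state_kernel s x * f x).
  under [RHS]eq_bigr do rewrite mulrBr.
  rewrite sumrB /=.
  under [X in _ = X - _]eq_bigr do rewrite occupancy_flow mulrDl.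
  rewrite big_split /= -addrA -[LHS]addr0; congr (_ + _); apply/esym/eqP.
  rewrite subr_eq0; apply/eqP.
  under eq_bigr do rewrite -mulrA mulr_suml.
  under [RHS]eq_bigr do rewrite mulrCA.
  rewrite -!mulr_sumr exchange_big /=; congr (_ * _).
  apply: eq_bigr => s _; rewrite mulr_sumr.
  by apply: eq_bigr => x _; rewrite mulrA.
rewrite -sumrB; apply: eq_bigr => s _; rewrite -mulrBr opprB addrA.
congr (_ * (_ - _)); rewrite sum_state_kernel mulr_sumr -big_split /=.
by apply: eq_bigr => a _; rewrite mulrDr [gamma * _]mulrCA.
Qed.

Lemma expected_discounted_sum_avg (mu : S -> R) (c : S -> A -> R) :
  is_dist mu ->
  expected_discounted_sum M pi mu c =
  avg mu (fun s => expected_discounted_sum M pi (point_mass R s) c).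
Proof.
move=> mu_dist; rewrite expected_discounted_sumE //.
under eq_bigr do rewrite mulr_suml; rewrite exchange_big /=.
apply: eq_bigr => x _; rewrite expected_discounted_sumE;
  last exact: dist_point_mass.
rewrite mulr_sumr; apply: eq_bigr => s _.
by rewrite /occupancy sum_point_mass mulrA.
Qed.

Lemma bellman (c : S -> A -> R) (s : S) :
  let v := fun s => expected_discounted_sum M pi (point_mass R s) c in
  v s = \sum_a pi s a * (c s a + gamma * \sum_x trans M s a x * v x).
Proof.
move=> v; have vE x : v x = \sum_y resolvent x y * \sum_a pi y a * c y a.
  rewrite /v expected_discounted_sumE; last exact: dist_point_mass.
  by apply: eq_bigr => y _; rewrite /occupancy sum_point_mass.
rewrite vE; under eq_bigr do rewrite resolvent_fixl mulrDl.
rewrite big_split /= sum_point_mass.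
under [RHS]eq_bigr do rewrite mulrDr mulrCA.
rewrite big_split /= -mulr_sumr -sum_state_kernel; congr (_ + _).
under eq_bigr do rewrite -mulrA.
rewrite -mulr_sumr; congr (_ * _).
under eq_bigr do rewrite mulr_suml; rewrite exchange_big /=.
apply: eq_bigr => x _; rewrite vE mulr_sumr; apply: eq_bigr => y _.
by rewrite mulrA.
Qed.

End Occupancy.

(** * Gibbs' inequality and its equality case *)

Section KullbackLeibler.
Variables (R : realType) (T : finType).
Implicit Types p q : T -> R.

Lemma dist_weighted_gt0 p (f : T -> R) :
  is_dist p -> (forall x, 0 < f x) -> 0 < \sum_x p x * f x.
Proof.
move=> [p0 p1] f0; rewrite lt_neqAle eq_sym.
have pf0 x : 0 <= p x * f x by rewrite mulr_ge0 // ltW.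
rewrite sumr_ge0 // andbT; apply/eqP => pf.
suff : \sum_x p x = 0 by rewrite p1 => /eqP; rewrite oner_eq0.
apply: big1 => x _; apply/eqP.
have /eqP := @psumr_eq0P _ _ xpredT _ (fun y _ => pf0 y) pf x isT.
by rewrite mulf_eq0 (gt_eqF (f0 x)) orbF.
Qed.

Lemma KLE p q : (forall x, 0 <= p x) -> (forall x, 0 < q x) ->
  KL p q = \sum_x p x * (ln (p x) - ln (q x)).
Proof.
move=> p0 q0; apply: eq_bigr => x _.
have := p0 x; rewrite le_eqVlt => /orP[/eqP <-|px]; first by rewrite !mul0r.
by rewrite ln_div ?posrE.
Qed.

(** This is ln(1 + x) <= x at x = b / a - 1. Summed over two distributions, the left-hand sides
    cancel, which gives [KL_ge0]. *)
Lemma KL_term_ge (a b : R) : 0 <= a -> 0 < b -> a - b <= a * ln (a / b).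
Proof.
rewrite le_eqVlt => /orP[/eqP <- b0|a0 b0].
  by rewrite mul0r sub0r oppr_le0 ltW.
rewrite ln_div ?posrE //.
have ba : -1 < b / a - 1 by rewrite ltrBrDl subrr divr_gt0.
have := le_ln1Dx ba; rewrite addrC subrK ln_div ?posrE // => h.
have : a * (ln b - ln a) <= a * (b / a - 1) by rewrite ler_pM2l.
have -> : a * (b / a - 1) = b - a by field; rewrite gt_eqF.
lra.
Qed.

(** Since exp x > 1 + x strictly for x != 0, equality forces ln b - ln a to vanish. *)
Lemma KL_term_eq (a b : R) :
  0 <= a -> 0 < b -> a * ln (a / b) = a - b -> a = b.
Proof.
rewrite le_eqVlt => /orP[/eqP <- b0|a0 b0].
  by rewrite mul0r sub0r => /eqP; rewrite eq_sym oppr_eq0 gt_eqF.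
rewrite ln_div ?posrE // => h.
have [e|ne] := eqVneq (ln b - ln a) 0.
  by apply: ln_inj; rewrite ?posrE //; apply/eqP; rewrite eq_sym -subr_eq0 e.
have := expR_gt1Dx ne; rewrite expRB !lnK ?posrE // => h2.
have : a * (1 + (ln b - ln a)) < a * (b / a) by rewrite ltr_pM2l.
rewrite [a * (b / a)]mulrCA divff ?gt_eqF // mulr1; lra.
Qed.

Lemma KL_ge0 p q : is_dist p -> is_dist q -> (forall x, 0 < q x) ->
  0 <= KL p q.
Proof.
move=> [p0 p1] [_ q1] q0.
have <- : \sum_x (p x - q x) = 0 by rewrite sumrB p1 q1 subrr.
by apply: ler_sum => x _; apply: KL_term_ge.
Qed.

Lemma KL_eq0 p q : is_dist p -> is_dist q -> (forall x, 0 < q x) ->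
  KL p q = 0 -> p =1 q.
Proof.
move=> [p0 p1] [_ q1] q0 pq x.
have t0 y : 0 <= p y * ln (p y / q y) - (p y - q y).
  by rewrite subr_ge0 KL_term_ge.
have ts : \sum_y (p y * ln (p y / q y) - (p y - q y)) = 0.
  by rewrite sumrB -/(KL p q) pq sumrB p1 q1 !subrr.
have /eqP := @psumr_eq0P _ _ xpredT _ (fun y _ => t0 y) ts x isT.
by rewrite subr_eq0 => /eqP; apply: KL_term_eq.
Qed.

(* e < 1 excludes y = 0 < x, where kl_ratio x y is the junk value x / 0 = 0. *)
Lemma kl_ratio_le (e x y : R) :
  0 < e < 1 -> 0 <= y -> `|kl_ratio x y - 1| <= e -> x <= (1 + e) * y.
Proof.
move=> /andP[e0 e1] y0; rewrite /kl_ratio.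
have [->|yn] := eqVneq y 0.
  have [->|xn] := eqVneq x 0; first by rewrite mulr0.
  rewrite /= invr0 mulr0 sub0r normrN normr1 => /(lt_le_trans e1).
  by rewrite ltxx.
have yp : 0 < y by rewrite lt_neqAle eq_sym yn.
by rewrite andbF => /ler_normlP[_]; rewrite lerBlDl ler_pdivrMr.
Qed.

End KullbackLeibler.

(** * Regularized performance differences and the structure of optimal policies *)

Section SoftPolicies.
Variables (R : realType) (S A : finType) (M : mdp R S A) (tau : R).
Implicit Types p pi : S -> A -> R.

(** The residual of V^pi under the regularized Bellman operator of [p]. The entropy charged is that
    of [p], whereas [Adv] charges that of [pi]; this is the source of the KL term in
    [soft_gain_Adv]. *)
Definition soft_gain pi p (s : S) : R :=
  \sum_a p s a * (Q M tau pi s a - tau * ln (p s a)) - V M tau pi s.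

(** An instance of [bellman_residual], with the regularized reward of [p] and f = V^pi. *)
Lemma performance_difference (rho : S -> R) pi p :
  is_dist rho -> is_policy p ->
  avg rho (V M tau p) - avg rho (V M tau pi) =
  \sum_s occupancy M p rho s * soft_gain pi p s.
Proof.
move=> rho_dist p_pol; rewrite -(expected_discounted_sum_avg _ p_pol) //.
rewrite bellman_residual //; apply: eq_bigr => s _; congr (_ * (_ - _)).
by apply: eq_bigr => a _; rewrite /Q addrAC.
Qed.

Lemma soft_gain_self pi (s : S) : is_policy pi -> soft_gain pi pi s = 0.
Proof.
move=> pi_pol; apply/eqP; rewrite subr_eq0 /V (bellman M pi_pol); apply/eqP.
by apply: eq_bigr => a _; rewrite /Q addrAC.
Qed.

Lemma soft_gain_Adv pi p (s : S) : is_policy p -> (forall s a, 0 < pi s a) ->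
  soft_gain pi p s =
  \sum_a p s a * Adv M tau pi s a - tau * KL (p s) (pi s).
Proof.
move=> p_pol pi0; rewrite KLE //; last exact: (p_pol s).1.
rewrite /soft_gain -[V _ _ _ _ in LHS](dist_avg_const _ (p_pol s)).
rewrite mulr_sumr -!sumrB; apply: eq_bigr => a _; rewrite /Adv; ring.
Qed.

(** The Boltzmann policy of [q] at temperature [tau]. *)
Definition soft_greedy (q : S -> A -> R) (s : S) (a : A) : R :=
  expR (q s a / tau) / \sum_b expR (q s b / tau).

(** The distribution [p s] sums to 1, so [A] is nonempty and the sum has a positive term. *)
Lemma sum_expR_gt0 p (g : A -> R) (s : S) :
  is_policy p -> 0 < \sum_a expR (g a).
Proof.
move=> /(_ s) p_dist; have [a pa] : exists a, p s a != 0.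
  apply/existsP; apply: contraT; rewrite negb_exists => /forallP pn.
  have [_] := p_dist; rewrite big1 => [/eqP|a _]; last exact/eqP/negPn/pn.
  by rewrite eq_sym oner_eq0.
by rewrite (bigD1 a) //= ltr_pwDl ?expR_gt0 // sumr_ge0.
Qed.

Hypothesis tau_gt0 : 0 < tau.

Lemma soft_greedy_gt0 p q (s : S) (a : A) :
  is_policy p -> 0 < soft_greedy q s a.
Proof.
by move=> p_pol; rewrite divr_gt0 ?expR_gt0 ?(sum_expR_gt0 _ s p_pol).
Qed.

Lemma soft_greedy_policy p q : is_policy p -> is_policy (soft_greedy q).
Proof.
move=> p_pol s; split=> [a|]; first exact/ltW/(soft_greedy_gt0 _ _ _ p_pol).
by rewrite -mulr_suml divff // gt_eqF // (sum_expR_gt0 _ s p_pol).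
Qed.

Lemma soft_greedyK p q (s : S) (a : A) : is_policy p ->
  q s a = tau * ln (soft_greedy q s a) + tau * ln (\sum_b expR (q s b / tau)).
Proof.
move=> p_pol; have Z0 := sum_expR_gt0 (fun b => q s b / tau) s p_pol.
rewrite ln_div ?posrE ?expR_gt0 // expRK -mulrDr subrK.
by rewrite mulrC divfK // gt_eqF.
Qed.

(* Gibbs variational principle: passing from pi to the soft-greedy policy of
   Q^pi gains tau KL, so an optimal policy is its own soft-greedy policy. *)
Lemma soft_gain_greedy pi p (s : S) : is_policy pi -> is_policy p ->
  soft_gain pi p s = tau * KL (pi s) (soft_greedy (Q M tau pi) s) -
                     tau * KL (p s) (soft_greedy (Q M tau pi) s).
Proof.
move=> pi_pol p_pol; rewrite -[LHS]subr0 -(soft_gain_self s pi_pol).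
rewrite opprB addrA subrK; set g := soft_greedy _.
have g0 b : 0 < g s b by exact: soft_greedy_gt0 pi_pol.
have KLg p' : is_policy p' ->
    \sum_a p' s a * (Q M tau pi s a - tau * ln (p' s a)) =
    tau * ln (\sum_b expR (Q M tau pi s b / tau)) - tau * KL (p' s) (g s).
  move=> p'_pol; rewrite KLE //; last exact: (p'_pol s).1.
  rewrite -[tau * ln (\sum_b _)](dist_avg_const _ (p'_pol s)).
  rewrite mulr_sumr -sumrB; apply: eq_bigr => a _.
  by rewrite [Q _ _ _ _ _ in LHS](soft_greedyK _ _ _ pi_pol) -/g; ring.
by rewrite !KLg //; ring.
Qed.

(** Start from the point mass at [s] and switch to the soft-greedy policy. Every state contributes a
    nonnegative gain and [s] has occupancy at least 1, so the value at [s] rises by at least tau KL;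
    optimality forces this KL to be 0. *)
Lemma optimal_soft_greedy pistar (s : S) (a : A) :
  is_optimal M tau pistar -> pistar s a = soft_greedy (Q M tau pistar) s a.
Proof.
move=> [st_pol st_opt]; set g := soft_greedy _.
have g_pol : is_policy g by exact: soft_greedy_policy st_pol.
have g0 s' b : 0 < g s' b by exact: soft_greedy_gt0 st_pol.
have KL0 : forall s', 0 <= KL (pistar s') (g s') by move=> s'; apply: KL_ge0.
have gain s' : soft_gain pistar g s' = tau * KL (pistar s') (g s').
  rewrite soft_gain_greedy // -/g [KL (g s') (g s')]big1 ?mulr0 ?subr0 //.
  move=> b _.
  by rewrite divff ?gt_eqF // ln1 mulr0.
have pm_dist := dist_point_mass R s.
have pm0 := pm_dist.1.
apply: KL_eq0 => //; apply/eqP; rewrite eq_le KL0 andbT.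
rewrite -(pmulr_rle0 _ tau_gt0) -gain.
have : V M tau g s - V M tau pistar s <= 0 by rewrite subr_le0 st_opt.
rewrite -(sum_point_mass s (V M tau g)) -(sum_point_mass s (V M tau pistar)).
rewrite -/(avg _ _) -/(avg _ _) performance_difference //.
apply: le_trans; rewrite (bigD1 s) //= ler_wpDr //.
  apply: sumr_ge0 => x _; apply: mulr_ge0.
    exact: le_trans (pm0 x) (occupancy_ge _ g_pol _ pm0).
  by rewrite gain mulr_ge0 // ltW.
rewrite ler_peMl //; first by rewrite gain mulr_ge0 // ltW.
apply: le_trans (occupancy_ge M g_pol s pm0).
by rewrite /point_mass eqxx.
Qed.

(** Full support of [pistar] makes [KL] with second argument [pistar] the genuine divergence. *)
Lemma optimal_gt0 pistar (s : S) (a : A) :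
  is_optimal M tau pistar -> 0 < pistar s a.
Proof.
move=> opt; rewrite optimal_soft_greedy //.
exact: soft_greedy_gt0 (proj1 opt).
Qed.

Lemma soft_gain_optimal pistar p (s : S) :
  is_optimal M tau pistar -> is_policy p ->
  soft_gain pistar p s = - (tau * KL (p s) (pistar s)).
Proof.
move=> opt p_pol; rewrite soft_gain_greedy //; last exact: (proj1 opt).
have -> : soft_greedy (Q M tau pistar) s = pistar s.
  by apply/funext => a; rewrite -optimal_soft_greedy.
rewrite [KL (pistar s) _]big1 ?mulr0 ?sub0r // => a _.
by rewrite divff ?ln1 ?mulr0 // gt_eqF // optimal_gt0.
Qed.

Lemma Vopt_optimal pistar : is_optimal M tau pistar ->
  Vopt M tau = V M tau pistar.
Proof.
move=> [st_pol st_opt]; apply/funext => s; apply/eqP; rewrite eq_le.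
have ub : ubound [set V M tau pi s | pi in [set pi | @is_policy R S A pi]]
    (V M tau pistar s) by move=> _ [p /= p_pol <-]; exact: st_opt.
apply/andP; split.
  by apply: ge_sup => //; exists (V M tau pistar s), pistar.
by apply: ub_le_sup; [exists (V M tau pistar s) | exists pistar].
Qed.

(** * A single NPG step *)

Section NPGStep.
Variable eta : R.
Hypothesis eta_gt0 : 0 < eta.

Lemma npg_step_gt0 pi (s : S) (a : A) :
  is_policy pi -> (forall s a, 0 < pi s a) -> 0 < npg_step M tau eta pi s a.
Proof.
move=> pi_pol pi0; rewrite divr_gt0 ?mulr_gt0 ?expR_gt0 //.
by apply: dist_weighted_gt0 => // b; exact: expR_gt0.
Qed.

Lemma npg_step_policy pi : is_policy pi -> (forall s a, 0 < pi s a) ->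
  is_policy (npg_step M tau eta pi).
Proof.
move=> pi_pol pi0 s; split=> [a|]; first exact/ltW/npg_step_gt0.
rewrite -mulr_suml divff // gt_eqF //.
by apply: dist_weighted_gt0 => // b; exact: expR_gt0.
Qed.

(* The NPG update makes the advantage a multiple of the log-ratio of the
   iterates, up to a normalization that Bellman's equation identifies as
   KL (pi s) (pi' s). *)
Lemma soft_gain_npg pi p (s : S) :
  is_policy pi -> (forall s a, 0 < pi s a) -> is_policy p ->
  let pi' := npg_step M tau eta pi in
  soft_gain pi p s =
  (tau + eta^-1) * (KL (p s) (pi s) - KL (p s) (pi' s) + KL (pi s) (pi' s))
  - tau * KL (p s) (pi s).
Proof.
move=> pi_pol pi0 p_pol pi'; have pi'0 : forall s a, 0 < pi' s a.
  by move=> *; exact: npg_step_gt0.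
have et1 : eta * tau + 1 != 0 by rewrite gt_eqF // addr_gt0 ?mulr_gt0.
set L := ln (\sum_b pi s b * expR (eta / (eta * tau + 1) * Adv M tau pi s b)).
(* The logarithm of the update is solved for [Adv]; the factor is the inverse of eta / (eta tau +
   1). *)
have Adv_log a : Adv M tau pi s a =
    (tau + eta^-1) * (ln (pi' s a) - ln (pi s a) + L).
  rewrite /pi' /npg_step ln_div ?lnM ?expRK ?posrE ?mulr_gt0 ?expR_gt0 //.
    by rewrite -/L; field; rewrite et1 gt_eqF.
  by apply: dist_weighted_gt0 => // b; exact: expR_gt0.
have AdvE p' : is_policy p' -> \sum_a p' s a * Adv M tau pi s a =
    (tau + eta^-1) * (KL (p' s) (pi s) - KL (p' s) (pi' s) + L).
  move=> p'_pol; have p'0 := (p'_pol s).1.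
  rewrite !KLE // -[L in RHS](dist_avg_const _ (p'_pol s)).
  rewrite -sumrB -big_split mulr_sumr /=; apply: eq_bigr => a _.
  by rewrite Adv_log; ring.
have KLpi : KL (pi s) (pi s) = 0.
  by rewrite /KL big1 // => b _; rewrite divff ?gt_eqF // ln1 mulr0.
have := soft_gain_self s pi_pol.
rewrite soft_gain_Adv // AdvE // KLpi mulr0 subr0 sub0r => /eqP.
rewrite mulf_eq0 gt_eqF ?addr_gt0 ?invr_gt0 //= addrC subr_eq0 => /eqP LE.
by rewrite soft_gain_Adv // AdvE // LE.
Qed.

End NPGStep.
End SoftPolicies.

(** * Scalar estimates: perturbing the exact contraction rate *)

Lemma ratio_gap (R : realType) (m D x : R) :
  1 <= m -> 0 <= D -> D <= m * x -> x <= m * D -> `|x - D| <= (m - 1) * D.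
Proof.
(* The lower bound x >= D / m is linearized through 1 / m >= 2 - m, that is, m (2 - m) = 1 - (m -
   1)^2 <= 1. *)
move=> m1 D0 Dx xD; have : m * ((2 - m) * D) <= m * x.
  apply: le_trans Dx; rewrite -subr_ge0.
  have -> : D - m * ((2 - m) * D) = (m - 1) ^+ 2 * D by ring.
  by rewrite mulr_ge0 ?sqr_ge0.
rewrite ler_pM2l; last exact: lt_le_trans m1.
by move=> h; rewrite ler_norml; apply/andP; split; lra.
Qed.

(* With m = 1 the identity forces (u + 1) ^+ 2 * D' = D; the slack m - 1 in
   the three comparisons perturbs this linearly. *)
Lemma rate_bounds (R : realType) (u m D D' x x' y : R) :
  0 < u -> 1 <= m -> 0 <= D' -> D' <= D ->
  D <= m * x -> x <= m * D -> D' <= m * x' -> x' <= m * D' ->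
  D - D' <= m * y -> y <= m * (D - D') ->
  (u + 2) * (u * D) = (u + 2) * (x - (u + 1) * x') + (u + 1) * u * y ->
  let sigma := (m - 1) * (((u + 2) ^+ 2 + u ^+ 2 + u) / 2) in
  (1 - sigma) / (u + 1) ^+ 2 * D <= D' /\
  D' <= (1 + sigma) / (u + 1) ^+ 2 * D.
Proof.
move=> u0 m1 D'0 D'D Dx xD D'x' x'D' Dy yD eqn sigma.
have D0 : 0 <= D := le_trans D'0 D'D.
have G0 : 0 <= D - D' by rewrite subr_ge0.
have E0 F : F <= D -> (m - 1) * F <= (m - 1) * D.
  by move=> FD; rewrite ler_wpM2l // subr_ge0.
have {Dx xD}/ler_normlP[a1 a2] := ratio_gap m1 D0 Dx xD.
have {D'x' x'D'}/ler_normlP[b1 b2] := ratio_gap m1 D'0 D'x' x'D'.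
have {Dy yD}/ler_normlP[c1 c2] := ratio_gap m1 G0 Dy yD.
have {E0}[Eb Ec] : (m - 1) * D' <= (m - 1) * D /\
    (m - 1) * (D - D') <= (m - 1) * D by split; apply: E0 => //; lra.
(* [sigma] is (m - 1) times half the sum of the coefficients of the three errors in [eqn2]; each
   error is at most (m - 1) D, as D' and D - D' lie below D. *)
have sE : sigma * D =
    ((u + 2) + (u + 2) * (u + 1) + (u + 1) * u) * ((m - 1) * D) / 2.
  by rewrite /sigma; field.
have u2 : 0 < u + 2 by lra.
have u12 : 0 < (u + 2) * (u + 1) by apply: mulr_gt0; lra.
have u10 : 0 < (u + 1) * u by apply: mulr_gt0; lra.
(* The hypothesis rewritten around its exact case x = D, x' = D', y = D - D', in which it reads 2 (u
   + 1)^2 D' = 2 D. *)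
have eqn2 : 2 * ((u + 1) ^+ 2 * D') = 2 * D + (u + 2) * (x - D)
    - (u + 2) * (u + 1) * (x' - D') + (u + 1) * u * (y - (D - D')).
  by move: eqn; lra.
move: eqn2 a1 a2 b1 b2 c1 c2 Eb Ec sE.
set E := (m - 1) * D; set e1 := x - D; set e2 := x' - D'.
set e3 := y - (D - D') => eqn2 a1 a2 b1 b2 c1 c2 Eb Ec sE.
have bnd c e : 0 < c -> e <= E -> - e <= E ->
    c * e <= c * E /\ - (c * E) <= c * e.
  move=> c0 h1 h2; rewrite -mulrN !ler_pM2l //; split=> //; lra.
have [p1 p2] := bnd _ e1 u2 a2 a1.
have [q1 q2] := bnd _ e2 u12 (le_trans b2 Eb) (le_trans b1 Eb).
have [r1 r2] := bnd _ e3 u10 (le_trans c2 Ec) (le_trans c1 Ec).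
have up : 0 < (u + 1) ^+ 2 by rewrite exprn_gt0 //; lra.
split; rewrite mulrAC ?ler_pdivrMr ?ler_pdivlMr // [D' * _]mulrC;
  rewrite ?mulrBl ?mulrDl mul1r; lra.
Qed.

(** * Transferring closeness of ratios to occupancy-weighted sums *)

Lemma weighted_sum_le (R : realType) (I : finType) (e d : R)
    (w w' f g : I -> R) :
  (forall i, 0 <= w i) -> (forall i, 0 <= f i) ->
  (forall i, w i <= (1 + d) * w' i) -> (forall i, f i <= (1 + e) * g i) ->
  \sum_i w i * f i <= (1 + e) * (1 + d) * \sum_i w' i * g i.
Proof.
move=> w0 f0 ww' fg; rewrite mulr_sumr; apply: ler_sum => i _.
apply: le_trans (ler_pM (w0 i) (f0 i) (ww' i) (fg i)) _.
by rewrite le_eqVlt; apply/orP; left; apply/eqP; ring.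
Qed.

(** The normalization 1 - gamma cancels in the ratio, and [rho s > 0] keeps the denominator
    positive. *)
Lemma occupancy_ratio_le (R : realType) (S A : finType) (M : mdp R S A)
    (p q : S -> A -> R) (rho : S -> R) (d : R) (s : S) :
  is_policy p -> is_policy q -> is_dist rho -> 0 < rho s ->
  `|visitation M p rho s / visitation M q rho s - 1| <= d ->
  occupancy M p rho s <= (1 + d) * occupancy M q rho s.
Proof.
move=> p_pol q_pol rho_dist rho0; have /andP[_ g1] := discount_01 M.
have q0 : 0 < occupancy M q rho s.
  exact: lt_le_trans (occupancy_ge M q_pol s rho_dist.1).
rewrite !visitationE // => /ler_normlP[_].
rewrite invfM mulrACA divff ?gt_eqF ?subr_gt0 // mul1r.
by rewrite lerBlDl ler_pdivrMr.
Qed.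

(** * Value identities along the NPG iterates *)

Lemma npg_sequence_policy (R : realType) (S A : finType) (M : mdp R S A)
    (tau eta : R) (pi : nat -> S -> A -> R) :
  npg_sequence M tau eta pi ->
  forall k, is_policy (pi k) /\ forall s a, 0 < pi k s a.
Proof.
move=> [pol0 pos0 step]; elim=> [//|k [pol pos]].
have -> : pi k.+1 = npg_step M tau eta (pi k).
  by apply/funext => s; apply/funext => a; rewrite step.
by split=> [|s a]; [exact: npg_step_policy | exact: npg_step_gt0].
Qed.

Section NPGRate.
Variables (R : realType) (S A : finType) (M : mdp R S A) (tau eta : R).
Hypotheses (tau_gt0 : 0 < tau) (eta_gt0 : 0 < eta).
Variables (rho : S -> R) (pistar : S -> A -> R) (pi : nat -> S -> A -> R).
Hypothesis rho_dist : is_dist rho.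
Hypothesis pistar_opt : is_optimal M tau pistar.
Hypothesis pi_npg : npg_sequence M tau eta pi.

Let gap k := avg rho (Vopt M tau) - avg rho (V M tau (pi k)).

Let pi_policy k : is_policy (pi k).
Proof. exact: (npg_sequence_policy pi_npg k).1. Qed.

Let pi_gt0 k s a : 0 < pi k s a.
Proof. exact: (npg_sequence_policy pi_npg k).2. Qed.

Let piS k : npg_step M tau eta (pi k) = pi k.+1.
Proof.
have [_ _ st] := pi_npg.
by apply/funext => s; apply/funext => a; rewrite st.
Qed.

(** The baseline is [pistar], so the occupancy is that of the iterate; [npg_gap_recurrence] reverses
    the roles and weights by the occupancy of [pistar]. *)
Lemma npg_gap k :
  gap k = tau * \sum_s occupancy M (pi k) rho s * KL (pi k s) (pistar s).
Proof.
rewrite /gap (Vopt_optimal pistar_opt) -opprB performance_difference //.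
rewrite -sumrN mulr_sumr; apply: eq_bigr => s _.
by rewrite soft_gain_optimal // mulrN opprK mulrCA.
Qed.

(** In [soft_gain_npg] with the new iterate as [p], its divergence from itself vanishes and the
    entropy correction reduces the coefficient of KL[k+1|k] to 1/eta. *)
Lemma npg_improvement k :
  gap k - gap k.+1 = \sum_s occupancy M (pi k.+1) rho s *
    (eta^-1 * KL (pi k.+1 s) (pi k s) +
     (tau + eta^-1) * KL (pi k s) (pi k.+1 s)).
Proof.
rewrite /gap opprB addrC subrKA performance_difference //.
apply: eq_bigr => s _; congr (_ * _).
rewrite (soft_gain_npg M tau_gt0 eta_gt0) // piS.
rewrite [KL (pi k.+1 s) (pi k.+1 s)]big1; first by ring.
by move=> a _; rewrite divff ?gt_eqF // ln1 mulr0.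
Qed.

Lemma npg_gap_recurrence k :
  let occ := occupancy M pistar rho in
  gap k = eta^-1 * \sum_s occ s * KL (pistar s) (pi k s)
    - (tau + eta^-1) * \sum_s occ s * KL (pistar s) (pi k.+1 s)
    + (tau + eta^-1) * \sum_s occ s * KL (pi k s) (pi k.+1 s).
Proof.
move=> occ; have st_pol := proj1 pistar_opt.
rewrite /gap (Vopt_optimal pistar_opt) performance_difference //.
rewrite !mulr_sumr -sumrB -big_split /=; apply: eq_bigr => s _.
by rewrite (soft_gain_npg M tau_gt0 eta_gt0) // piS /occ; ring.
Qed.

End NPGRate.

(** * Assembly of the two-sided rate *)

Theorem theorem6p17 (R : realType) (S A : finType) (M : mdp R S A)
  (tau eta : R) (tau_gt0 : 0 < tau) (eta_gt0 : 0 < eta)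
  (rho : S -> R) (rho_dist : is_dist rho) (rho_gt0 : forall s, 0 < rho s)
  (pistar : S -> A -> R) (pistar_opt : is_optimal M tau pistar)
  (pi : nat -> S -> A -> R) (pi_npg : npg_sequence M tau eta pi) :
  exists sigma1 sigma2 : R -> R -> R,
    [/\ forall eps delta : R, 0 < eps < 1 -> 0 < delta < 1 ->
          0 <= sigma1 eps delta /\ 0 <= sigma2 eps delta,
        sigma1 x.1 x.2 @[x --> (0^'+, 0^'+)] --> (0 : R),
        sigma2 x.1 x.2 @[x --> (0^'+, 0^'+)] --> (0 : R) &
        forall (eps delta : R) (T : nat),
          0 < eps < 1 -> 0 < delta < 1 ->
          (forall k, (T <= k)%N -> forall s,
            [/\ kl_close eps (pi k s) (pi k.+1 s),
                kl_close eps (pi k s) (pistar s),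
                `|visitation M pistar rho s / visitation M (pi k) rho s - 1|
                  <= delta &
                `|visitation M (pi k) rho s / visitation M pistar rho s - 1|
                  <= delta]) ->
          forall k, (T <= k)%N ->
            (1 - sigma1 eps delta) / (eta * tau + 1) ^+ 2
                * (avg rho (Vopt M tau) - avg rho (V M tau (pi k)))
              <= avg rho (Vopt M tau) - avg rho (V M tau (pi k.+1)) /\
            avg rho (Vopt M tau) - avg rho (V M tau (pi k.+1))
              <= (1 + sigma2 eps delta) / (eta * tau + 1) ^+ 2
                * (avg rho (Vopt M tau) - avg rho (V M tau (pi k)))].
Proof.
set u := eta * tau; have u0 : 0 < u by exact: mulr_gt0.
(* The constant of [rate_bounds] with m = (1 + e) (1 + d); it serves both sides. *)
pose sigma (e d : R) : R :=
  ((1 + e) * (1 + d) - 1) * (((u + 2) ^+ 2 + u ^+ 2 + u) / 2).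
have C0 : 0 <= ((u + 2) ^+ 2 + u ^+ 2 + u) / 2 by nra.
have m_ge1 (e d : R) : 0 < e < 1 -> 0 < d < 1 -> 1 <= (1 + e) * (1 + d).
  by move=> /andP[e0 _] /andP[d0 _]; nra.
have sigma_cvg : sigma x.1 x.2 @[x --> (0^'+, 0^'+)] --> (0 : R).
  have fst0 : x.1 @[x --> ((0 : R)^'+, (0 : R)^'+)] --> (0 : R).
    apply: (cvg_trans (@cvg_fst _ _ (0 : R)^'+ (0 : R)^'+ _)).
    exact: cvg_within.
  have snd0 : x.2 @[x --> ((0 : R)^'+, (0 : R)^'+)] --> (0 : R).
    apply: (cvg_trans (@cvg_snd _ _ (0 : R)^'+ (0 : R)^'+ _)).
    exact: cvg_within.
  have sigma00 : sigma 0 0 = 0 by rewrite /sigma !addr0 mulr1 subrr mul0r.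
  rewrite -[X in _ --> X]sigma00.
  apply: cvgMr_tmp; apply: cvgB; last exact: cvg_cst.
  by apply: cvgM; [exact: cvgD (cvg_cst _) fst0 | exact: cvgD (cvg_cst _) snd0].
exists sigma, sigma; split=> // [e d e01 d01|e d T e01 d01 close k Tk].
  by split; rewrite mulr_ge0 // subr_ge0 m_ge1.
have pol j := (npg_sequence_policy pi_npg j).1.
have pos j := (npg_sequence_policy pi_npg j).2.
have st_pol := proj1 pistar_opt.
have st_pos s a := @optimal_gt0 _ _ _ M tau tau_gt0 pistar s a pistar_opt.
have occ0 p : is_policy p -> forall s, 0 <= occupancy M p rho s.
  move=> p_pol s; apply: le_trans (ltW (rho_gt0 s)) _.
  exact: (occupancy_ge M p_pol s rho_dist.1).
have KL0 (p q : S -> A -> R) s :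
    is_policy p -> is_policy q -> (forall s a, 0 < q s a) ->
  0 <= KL (p s) (q s) by move=> *; exact: KL_ge0.
have klc (p q : S -> A -> R) s :
    is_policy p -> is_policy q -> (forall s a, 0 < p s a) ->
    (forall s a, 0 < q s a) -> kl_close e (p s) (q s) ->
    KL (p s) (q s) <= (1 + e) * KL (q s) (p s) /\
    KL (q s) (p s) <= (1 + e) * KL (p s) (q s).
  by move=> ? ? ? ? [h1 h2]; split; apply: kl_ratio_le => //; exact: KL0.
have occ_st j (Tj : (T <= j)%N) s :
    occupancy M pistar rho s <= (1 + d) * occupancy M (pi j) rho s.
  by have [_ _ h _] := close j Tj s; exact: occupancy_ratio_le h.
have occ_pi j (Tj : (T <= j)%N) s :
    occupancy M (pi j) rho s <= (1 + d) * occupancy M pistar rho s.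
  by have [_ _ _ h] := close j Tj s; exact: occupancy_ratio_le h.
pose gap j := avg rho (Vopt M tau) - avg rho (V M tau (pi j)).
(* [a j] is [gap j] as given by [npg_gap], with the KL arguments exchanged and the occupancy
   replaced by that of [pistar]. *)
pose a j := tau * \sum_s occupancy M pistar rho s * KL (pistar s) (pi j s).
pose b := \sum_s occupancy M pistar rho s * KL (pi k s) (pi k.+1 s).
(* The total coefficient in [npg_improvement] once KL[k+1|k] is replaced by KL[k|k+1]. *)
pose beta := eta^-1 + (tau + eta^-1).
have ei0 : 0 < eta^-1 by rewrite invr_gt0.
have al0 : 0 < tau + eta^-1 by rewrite addr_gt0.
have gapE j : gap j = _ := npg_gap tau_gt0 rho_dist pistar_opt pi_npg j.
have gap0 j : 0 <= gap j.
  rewrite gapE mulr_ge0 ?sumr_ge0 // => [|s _]; first exact: ltW.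
  by rewrite mulr_ge0 ?occ0 ?KL0.
have impE : gap k - gap k.+1 = _ :=
  npg_improvement tau_gt0 eta_gt0 rho_dist pi_npg k.
have imp0 : 0 <= gap k - gap k.+1.
  rewrite impE sumr_ge0 // => s _; rewrite mulr_ge0 ?occ0 //.
  by rewrite addr_ge0 // mulr_ge0 ?KL0 // ltW.
set m := (1 + e) * (1 + d).
have gap_a j : (T <= j)%N -> gap j <= m * a j /\ a j <= m * gap j.
  move=> Tj; rewrite gapE /a !(mulrCA m) !ler_pM2l //.
  split; apply: weighted_sum_le => s; rewrite ?occ0 ?KL0 ?occ_st ?occ_pi //;
    by have [_ h _ _] := close j Tj s; apply klc in h => //; case: h.
have e0 : 0 <= e by case/andP: e01 => /ltW.
have imp_b : gap k - gap k.+1 <= m * (beta * b) /\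
    beta * b <= m * (gap k - gap k.+1).
  have klb s : KL (pi k s) (pi k.+1 s) <= (1 + e) * KL (pi k.+1 s) (pi k s) /\
      KL (pi k.+1 s) (pi k s) <= (1 + e) * KL (pi k s) (pi k.+1 s).
    by have [h _ _ _] := close k Tk s; exact: klc.
  (* The improvement is weighted by the occupancy of iterate k + 1, so the visitation bounds are
     used one step later than the KL bounds. *)
  have TkS : (T <= k.+1)%N by exact: leqW.
  have -> : beta * b = \sum_s occupancy M pistar rho s *
      (beta * KL (pi k s) (pi k.+1 s)).
    by rewrite /b mulr_sumr; apply: eq_bigr => s _; rewrite mulrCA.
  rewrite impE.
  (* Only KL[k+1|k] is exchanged; the part already in KL[k|k+1] is just enlarged by 1 + e >= 1. *)
  split; apply: weighted_sum_le => s; rewrite ?occ0 ?occ_st ?occ_pi //.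
  - by rewrite addr_ge0 // mulr_ge0 ?KL0 // ltW.
  - have [_ h] := klb s; have kl0 := KL0 _ _ s (pol k) (pol k.+1) (pos k.+1).
    rewrite [leRHS]mulrCA /beta [leRHS]mulrDl.
    by apply: lerD; rewrite ler_pM2l // mulrDl mul1r lerDl mulr_ge0.
  - by rewrite mulr_ge0 ?KL0 // ltW // addr_gt0.
  - have [h _] := klb s; have kl0 := KL0 _ _ s (pol k) (pol k.+1) (pos k.+1).
    rewrite /beta mulrDl [leRHS]mulrDr ![(1 + e) * (_ * _)]mulrCA.
    by apply: lerD; rewrite ler_pM2l // mulrDl mul1r lerDl mulr_ge0.
have [h1 h2] := gap_a k Tk; have [h3 h4] := gap_a k.+1 (leqW Tk).
have [h5 h6] := imp_b.
(* Here x = [a k], x' = [a k.+1] and y = [beta * b]. *)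
apply: (rate_bounds u0 _ (gap0 k.+1) _ h1 h2 h3 h4 h5 h6); rewrite ?m_ge1 //.
  by rewrite -subr_ge0.
(* The remaining identity is the recurrence multiplied by u (u + 2), using u beta = (u + 2) tau. *)
have -> : gap k = _ :=
  npg_gap_recurrence tau_gt0 eta_gt0 rho_dist pistar_opt pi_npg k.
by rewrite -/b /a /beta /u; field; rewrite gt_eqF.
Qed.
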